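(* Let $\mathcal L$ be a noncommutative Lie algebra over a field and let $S$ be a non-empty subset of the vertex set $V_{\mathcal L}$ such that the subgraph $\Gamma(S)$ of $\Gamma(\mathcal L)$ induced by $S$ is connected. Suppose that the series of closed neighborhoods of $S$ terminates at a positive integer $d$. Then $\Gamma(\mathcal L)$ is connected if and only if $N^d(S)=V_{\mathcal L}$. Moreover, if $N^d(S)=V_{\mathcal L}$ then $\mathrm{diam}(\Gamma(\mathcal L))\le 2d+\mathrm{diam}(\Gamma(S))$.
   Context: For a noncommutative (i.e. nonabelian) Lie algebra $\mathcal L$ with center $Z(\mathcal L)$, the commuting graph $\Gamma(\mathcal L)$ is the simple undirected graph with vertex set $V_{\mathcal L}=\mathcal L\setminus Z(\mathcal L)$, in which two distinct vertices $x,y$ are adjacent if and only if $[x,y]=0$. The distance between two vertices is the length (number of edges) of a shortest path joining them, a graph is connected if every pair of distinct vertices is joined by a path, and the diameter of a connected graph is the supremum (possibly $\infty$) of the distances between distinct vertices (it is $0$ for a one-vertex graph). For $S\subseteq V_{\mathcal L}$, the closed neighborhood of $S$ is $N(S)=\{x\in\mathcal L\setminus Z(\mathcal L) : [x,s]=0\text{ for some }s\in S\}$. Put $N^0(S)=S$ and $N^k(S)=N(N^{k-1}(S))$ for $k\ge 1$; the series of closed neighborhoods of $S$ is $N^0(S)\subseteq N^1(S)\subseteq N^2(S)\subseteq\cdots$. It is said to terminate at $k$ if $N^{k-1}(S)\subsetneq N^k(S)=N^{k+1}(S)$. *)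

(* Defs.v *)
From HB Require Import structures.
From mathcomp Require Import all_boot all_order all_algebra.
From mathcomp Require Import boolp classical_sets constructive_ereal.
Set Implicit Arguments.
Unset Strict Implicit.
Unset Printing Implicit Defensive.
Import GRing.Theory.
Local Open Scope ring_scope.
Local Open Scope classical_set_scope.

HB.mixin Record Lmodule_isLieAlgebra (F : fieldType) L of GRing.Lmodule F L := {
  bracket : L -> L -> L;
  bracket_linearr : forall x, linear (bracket x);
  bracket_linearl : forall y, linear (fun x => bracket x y);
  bracketxx : forall x, bracket x x = 0;
  jacobi : forall x y z,
    bracket x (bracket y z) + bracket y (bracket z x) + bracket z (bracket x y)
    = 0
}.

(* The underlying vector space may have infinite dimension. *)
#[short(type="lieAlgType")]
HB.structure Definition LieAlgebra (F : fieldType) :=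
  {L of GRing.Lmodule F L & Lmodule_isLieAlgebra F L}.

(* Only the restriction of [adj] to [vertices] is meaningful: every notion
   below looks at [adj] between elements of [vertices] only. *)
Record sgraph (T : eqType) := SGraph {
  vertices : set T;
  adj : rel T;
  adj_sym : symmetric adj;
  adj_irr : irreflexive adj
}.

Section Graph.
Variable T : eqType.
Implicit Types (G : sgraph T) (x y : T) (p : seq T).

Definition induced G (S : set T) : sgraph T :=
  SGraph (vertices G `&` S) (@adj_sym _ G) (@adj_irr _ G).

(* The path visits x :: p, so its length (number of edges) is [size p]. *)
Definition is_path G x y p : Prop :=
  [/\ forall z, z \in x :: p -> vertices G z,
      path (adj G) x p, uniq (x :: p) & last x p = y].

Definition gconnected G : Prop :=
  forall x y, vertices G x -> vertices G y -> x != y ->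
    exists p, is_path G x y p.

(* Lengths live in [\bar int], in which every set has a supremum and an
   infimum; the distance is +oo when no path joins x and y. *)
Definition gdist G x y : \bar int :=
  infimum +oo%E [set ((size p)%:Z)%:E | p in is_path G x y].

(* The default value 0 is used when there are no two distinct vertices. *)
Definition diam G : \bar int :=
  supremum 0%E [set k | exists x y,
    [/\ vertices G x, vertices G y, x != y & k = gdist G x y]].

End Graph.

Section CommutingGraph.
Variables (F : fieldType) (L : lieAlgType F).
Implicit Types (x y : L) (S : set L).

Definition noncommutative : Prop := exists x y : L, bracket x y != 0.

Definition lie_center : set L := [set x | forall y, bracket x y = 0].

Lemma bracketC x y : bracket x y = - bracket y x.
Proof.
have bDr u v w : bracket u (v + w) = bracket u v + bracket u w :> L.
  by have := bracket_linearr u 1 v w; rewrite !scale1r.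
have bDl u v w : bracket (u + v) w = bracket u w + bracket v w :> L.
  by have := bracket_linearl w 1 u v; rewrite !scale1r.
apply/eqP; rewrite -addr_eq0; apply/eqP.
have := bracketxx (x + y).
by rewrite bDl !bDr !bracketxx add0r addr0.
Qed.

Definition commuting_adj : rel L := fun x y => (x != y) && (bracket x y == 0).

Lemma commuting_adj_sym : symmetric commuting_adj.
Proof.
by move=> x y; rewrite /commuting_adj eq_sym (bracketC x y) oppr_eq0.
Qed.

Lemma commuting_adj_irr : irreflexive commuting_adj.
Proof. by move=> x; rewrite /commuting_adj eqxx. Qed.

Definition commuting_graph : sgraph L :=
  SGraph (~` lie_center) commuting_adj_sym commuting_adj_irr.

Definition closed_nbhd S : set L :=
  [set x | (~` lie_center) x /\ exists2 s, S s & bracket x s = 0].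

Definition closed_nbhd_iter (k : nat) S : set L := iter k closed_nbhd S.

Definition nbhd_series_terminates_at S (k : nat) : Prop :=
  [/\ (0 < k)%N,
      closed_nbhd_iter k.-1 S `<` closed_nbhd_iter k S
    & closed_nbhd_iter k S = closed_nbhd_iter k.+1 S].

End CommutingGraph.

Arguments noncommutative {F} L.
Arguments lie_center {F} L.
Arguments commuting_graph {F} L.

(* Main.v *)
Require Import Defs.
From mathcomp Require Import all_boot all_order all_algebra.
From mathcomp Require Import boolp classical_sets constructive_ereal.
Set Implicit Arguments.
Unset Strict Implicit.
Unset Printing Implicit Defensive.
Local Open Scope ring_scope.
Local Open Scope classical_set_scope.

(** Unfolding the iterated neighborhoods, a vertex of [N^k(S)] is joined to
    some element of [S] by a walk of length at most [k]
    ([closed_nbhd_iter_linked]).  So if [N^d(S)] contains every vertex, two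
    vertices [x] and [y] are joined by a walk which goes from [x] to some [s]
    in [S], then inside [S] from [s] to some [t], then from [t] to [y].  The
    outer parts have length at most [d] each, and the middle part can be taken
    of length at most the diameter of the graph induced by [S]
    ([linked_within_diam]).  A walk shortens to a path between the same
    endpoints ([linked_is_path]), which gives both connectedness and the bound
    on the diameter.

    Conversely, since the series is stationary from [d] on, [N^d(S)] is closed
    under adjacency. It contains the nonempty set [S], so in a connected graph
    it contains every vertex.

    The distances and diameters are infima and suprema in the integers extended
    by infinities.  Since lengths are natural numbers, well-foundedness shows
    that the infimum defining a finite distance is attained
    ([gdist_attained]) and that the supremum defining the diameter is a true
    least upper bound ([supremums_ge0], [gdist_le_diam]). *)

Import Order.TTheory GRing.Theory Num.Theory.

(** * Suprema and infima *)

Lemma infimum_min (disp : Order.disp_t) (T : porderType disp) (x0 m : T)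
    (A : set T) :
  A m -> lbound A m -> infimum x0 A = m.
Proof.
move=> Am lbm; have mA : infimums A m by split=> // b; apply.
rewrite /infimum ifF; last by apply/negP => /eqP A0; rewrite A0 in Am.
case: xgetP => [y _ yA|/(_ m)//]; exact: is_subset1_infimums yA mA.
Qed.

(** An upper bound of a nonempty set of nonnegative elements is a natural
    number or [+oo], so there is a least one. *)
Lemma supremums_ge0 (A : set (\bar int)) :
  A !=set0 -> (forall a, A a -> (0 <= a)%E) -> supremums A !=set0.
Proof.
move=> [a Aa] A0.
have ub_cases b : ubound A b -> b = +oo%E \/ exists n : nat, b = n%:Z%:E.
  move=> /(_ _ Aa) ab; have := le_trans (A0 _ Aa) ab.
  by case: b {ab} => [[n|n]| |] //; [right; exists n|left].
have [ubN|no_ub] := pselect (exists n : nat, `[< ubound A n%:Z%:E >]).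
  exists (ex_minn ubN)%:Z%:E; case: ex_minnP => m /asboolP ubm min_m.
  split=> // b ubb; have [->|[n bE]] := ub_cases b ubb; first exact: leey.
  by rewrite bE lee_fin lez_nat min_m //; apply/asboolP; rewrite -bE.
exists +oo%E; split=> [x _|b ubb]; first exact: leey.
have [->//|[n bE]] := ub_cases b ubb.
by case: no_ub; exists n; apply/asboolP; rewrite -bE.
Qed.

(** * Walks, distances and diameter *)

Section Walks.
Context {T : eqType}.
Implicit Types (G : sgraph T) (x y z : T) (n : nat).

(** Walks may repeat vertices, hence they compose and reverse freely, and only
    a bound on their length is recorded. *)
Definition linked G n x y : Prop := exists p,
  [/\ forall z, z \in x :: p -> vertices G z, path (adj G) x p,
      last x p = y & (size p <= n)%N].

Lemma linked_refl G x : vertices G x -> linked G 0 x x.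
Proof. by move=> Gx; exists [::]; split=> // z; rewrite inE => /eqP->. Qed.

Lemma linkedW G m n x y : (m <= n)%N -> linked G m x y -> linked G n x y.
Proof.
by move=> mn [p [Gp pp lp sp]]; exists p; split=> //; exact: leq_trans mn.
Qed.

Lemma linked_adj G x y :
  vertices G x -> vertices G y -> adj G x y -> linked G 1 x y.
Proof.
move=> Gx Gy xy; exists [:: y]; split=> //= [z|]; last by rewrite xy.
by rewrite !inE => /orP[] /eqP->.
Qed.

Lemma linkedD G m n x y z :
  linked G m x y -> linked G n y z -> linked G (m + n) x z.
Proof.
move=> [p [Gp pp lp sp]] [q [Gq pq lq sq]]; exists (p ++ q).
split; last by rewrite size_cat leq_add.
- move=> u; rewrite -cat_cons mem_cat => /orP[/Gp//|uq].
  by apply: Gq; rewrite inE uq orbT.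
- by rewrite cat_path pp lp.
- by rewrite last_cat lp.
Qed.

Lemma linkedC G n x y : linked G n x y -> linked G n y x.
Proof.
move=> [p [Gp pp lp sp]]; exists (rev (belast x p)); split.
- by move=> z; rewrite -lp -rev_rcons -lastI mem_rev => /Gp.
- by rewrite -lp rev_path (eq_path (e' := adj G)) // => u v; rewrite adj_sym.
- by case: p lp {Gp pp sp} => //= u p _; rewrite rev_cons last_rcons.
- by rewrite size_rev size_belast.
Qed.

Lemma linked_induced G (S : set T) n x y :
  linked (induced G S) n x y -> linked G n x y.
Proof. by move=> [p [Gp pp lp sp]]; exists p; split=> // z /Gp[]. Qed.

Lemma is_path_linked G x y p : is_path G x y p -> linked G (size p) x y.
Proof. by move=> [Gp pp _ lp]; exists p. Qed.

(** Cutting out the loops of a walk leaves a path. *)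
Lemma linked_is_path G n x y :
  linked G n x y -> exists2 p, is_path G x y p & (size p <= n)%N.
Proof.
move=> [p [Gp pp <- sp]]; case/shortenP: pp => q pq uq qp.
exists q; last by apply: leq_trans sp; apply: uniq_leq_size qp; case/andP: uq.
split=> // z; rewrite inE => /orP[/eqP->|/qp zp]; apply: Gp.
  exact: mem_head.
by rewrite inE zp orbT.
Qed.

Lemma gdist_attained G x y p : is_path G x y p ->
  exists q, [/\ is_path G x y q, gdist G x y = (size q)%:Z%:E
              & (size q <= size p)%N].
Proof.
move=> Pp.
have exP : exists n, `[< exists2 q, is_path G x y q & size q = n >].
  by exists (size p); apply/asboolP; exists p.
case: (ex_minnP exP) => n /asboolP[q Pq qn] min_n.
have min_q r : is_path G x y r -> (size q <= size r)%N.
  by move=> Pr; rewrite qn; apply/min_n/asboolP; exists r.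
exists q; split=> //; last exact: min_q.
apply: infimum_min; first by exists q.
by move=> _ [r Pr <-]; rewrite lee_fin lez_nat min_q.
Qed.

Lemma gdist_ge0 G x y : (0 <= gdist G x y)%E.
Proof.
have [[p Pp]|noP] := pselect (exists p, is_path G x y p).
  by have [q [_ -> _]] := gdist_attained Pp; rewrite lee_fin.
rewrite /gdist /infimum ifT; first exact: leey.
by apply/eqP; rewrite -subset0 => k [p Pp]; case: noP; exists p.
Qed.

Lemma gdist_le G n x y : linked G n x y -> (gdist G x y <= n%:Z%:E)%E.
Proof.
move=> /linked_is_path[p Pp pn]; have [q [_ -> qp]] := gdist_attained Pp.
by rewrite lee_fin lez_nat (leq_trans qp).
Qed.

Lemma gdist_le_diam G x y : vertices G x -> vertices G y -> x != y ->
  (gdist G x y <= diam G)%E.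
Proof.
move=> Gx Gy xy.
set A := [set k | exists x y,
  [/\ vertices G x, vertices G y, x != y & k = gdist G x y]].
have Axy : A (gdist G x y) by exists x, y.
apply: ge_supremum_Nmem (Axy).
apply: supremums_ge0; first by exists (gdist G x y).
by move=> _ [u [v [_ _ _ ->]]]; exact: gdist_ge0.
Qed.

Lemma diam_ge0 G : (0 <= diam G)%E.
Proof.
have [[x [y [Gx Gy xy]]]|no_pair] :=
  pselect (exists x y, [/\ vertices G x, vertices G y & x != y]).
  exact: le_trans (gdist_ge0 G x y) (gdist_le_diam Gx Gy xy).
rewrite /diam /supremum ifT //; apply/eqP; rewrite -subset0.
by move=> k [x [y [Gx Gy xy _]]]; apply: no_pair; exists x, y.
Qed.

(** The default value [0] of the diameter makes [0 <= c] necessary when there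
    are no two distinct vertices. *)
Lemma diam_le G (c : \bar int) : (0 <= c)%E ->
  (forall x y, vertices G x -> vertices G y -> x != y ->
    (gdist G x y <= c)%E) ->
  (diam G <= c)%E.
Proof.
move=> c0 Gc; rewrite /diam /supremum; case: ifP => // _.
case: xgetP => // k kE [_]; apply.
by move=> _ [x [y [Gx Gy xy ->]]]; exact: Gc.
Qed.

Lemma linked_within_diam G x y : gconnected G -> vertices G x -> vertices G y ->
  exists2 n, linked G n x y & (n%:Z%:E <= diam G)%E.
Proof.
move=> Gconn Gx Gy; have [<-|xy] := eqVneq x y.
  by exists 0%N; [exact: linked_refl|exact: diam_ge0].
have [p Pp] := Gconn _ _ Gx Gy xy; have [q [Pq dq _]] := gdist_attained Pp.
exists (size q); first exact: is_path_linked.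
by rewrite -dq; exact: gdist_le_diam.
Qed.

End Walks.

(** * Closed neighborhoods in the commuting graph *)

Section Neighborhoods.
Context {F : fieldType} {L : lieAlgType F}.
Implicit Types (S : set L) (x y : L) (k n : nat).

Lemma closed_nbhd_iter_vertices S k :
  S `<=` vertices (commuting_graph L) ->
  closed_nbhd_iter k S `<=` vertices (commuting_graph L).
Proof. by move=> SV; case: k => [|k] // x []. Qed.

(** A vertex commutes with itself, so closed neighborhoods grow. *)
Lemma sub_closed_nbhd_iter S k :
  S `<=` vertices (commuting_graph L) -> S `<=` closed_nbhd_iter k S.
Proof.
move=> SV; elim: k => [//|k IHk] x Sx; split; first exact: SV.
by exists x; [exact: IHk|exact: bracketxx].
Qed.

Lemma closed_nbhd_iter_linked S k x :
  S `<=` vertices (commuting_graph L) -> closed_nbhd_iter k S x ->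
  exists2 s, S s & linked (commuting_graph L) k x s.
Proof.
move=> SV; elim: k x => [|k IHk] x.
  by move=> Sx; exists x => //; apply: linked_refl; exact: SV.
move=> [Vx [y Ny xy0]]; have [s Ss ys] := IHk y Ny; exists s => //.
rewrite -add1n; apply: linkedD ys.
(* [y] may be [x] itself, in which case this step has length 0 *)
have [<-|xy] := eqVneq x y.
  exact: linkedW (leq0n 1) (linked_refl (G := commuting_graph L) Vx).
apply: linked_adj => //; first exact: closed_nbhd_iter_vertices SV _ Ny.
by rewrite /= /commuting_adj xy xy0 eqxx.
Qed.

(** Being closed under taking neighborhoods means being a union of connected
    components; this is applied to the terminal [N^d(S)]. *)
Lemma stable_closed_nbhd_linked S n x y :
  closed_nbhd S `<=` S -> linked (commuting_graph L) n x y -> S y -> S x.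
Proof.
move=> NS [p [Vp pp lp _]] Sy; elim: p x Vp pp lp => [|z p IHp] x Vp /=.
  by move=> _ ->.
case/andP=> /andP[_ /eqP xz0] pp lp; apply: NS; split.
  by apply: Vp; exact: mem_head.
exists z => //; apply: IHp => // u up; apply: Vp.
by rewrite inE up orbT.
Qed.

(** This walk yields both connectedness and the bound on the diameter. *)
Lemma linked_through S d x y :
  S `<=` vertices (commuting_graph L) ->
  gconnected (induced (commuting_graph L) S) ->
  closed_nbhd_iter d S x -> closed_nbhd_iter d S y ->
  exists2 n, linked (commuting_graph L) (2 * d + n) x y
           & (n%:Z%:E <= diam (induced (commuting_graph L) S))%E.
Proof.
move=> SV Sconn /(closed_nbhd_iter_linked SV)[s Ss xs].
move=> /(closed_nbhd_iter_linked SV)[t St /linkedC ty].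
have [n st nS] := linked_within_diam Sconn (conj (SV _ Ss) Ss)
  (conj (SV _ St) St).
exists n => //; rewrite mul2n -addnn -addnA [(d + n)%N]addnC addnA.
exact: linkedD (linkedD xs (linked_induced st)) ty.
Qed.

End Neighborhoods.

Theorem theorem16 (F : fieldType) (L : lieAlgType F) (S : set L) (d : nat)
    (L_noncomm : noncommutative L)
    (S_neq0 : S !=set0)
    (S_vertices : S `<=` vertices (commuting_graph L))
    (S_connected : gconnected (induced (commuting_graph L) S))
    (S_terminates : nbhd_series_terminates_at S d) :
  (gconnected (commuting_graph L) <->
     closed_nbhd_iter d S = vertices (commuting_graph L)) /\
  (closed_nbhd_iter d S = vertices (commuting_graph L) ->
     (diam (commuting_graph L) <=
        ((2 * d)%N%:Z)%:E + diam (induced (commuting_graph L) S))%E).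
Proof.
split; first split=> [Lconn|NV].
- apply/seteqP; split; first exact: closed_nbhd_iter_vertices.
  move=> x Vx; have [s Ss] := S_neq0.
  have Ns := sub_closed_nbhd_iter d S_vertices Ss.
  have [->//|xs] := eqVneq x s.
  have [p /is_path_linked xps] := Lconn _ _ Vx (S_vertices _ Ss) xs.
  apply: stable_closed_nbhd_linked xps Ns.
  by case: S_terminates => _ _ Nd z Nz; rewrite Nd.
- move=> x y; rewrite -NV => Nx Ny _.
  have [n xy _] := linked_through S_vertices S_connected Nx Ny.
  by have [p Pp _] := linked_is_path xy; exists p.
move=> NV; apply: diam_le => [|x y]; first by rewrite adde_ge0 ?diam_ge0.
rewrite -NV => Nx Ny _.
have [n xy nS] := linked_through S_vertices S_connected Nx Ny.
apply: le_trans (gdist_le xy) _.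
by rewrite PoszD EFinD; apply: leeD.
Qed.
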